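(* Let $M,N\in\mathcal{X}$ be such that $\{M,N\}$ is adequate. Then the remainder set $R_M(N)$ of $N$ over $M$ is finite.
   Context: Standing assumptions and notation. Assume $2^{\omega_1}=\omega_2$ and fix a bijection $\pi:\omega_2\to H(\omega_2)$. $P_{\omega_1}(\omega_2)$ is the set of countable subsets of $\omega_2$. Assume there is a stationary set $\mathcal{Y}\subseteq P_{\omega_1}(\omega_2)$ which is thin, i.e. for all $\beta<\omega_2$ the set $\{a\cap\beta: a\in\mathcal{Y}\}$ has size at most $\omega_1$; fix such a $\mathcal{Y}$ which is moreover closed under initial segments ($a\in\mathcal{Y}$, $\beta<\omega_2$ imply $a\cap\beta\in\mathcal{Y}$). Let $\mathcal{A}$ be the structure $(H(\omega_2),\in,\pi,\mathcal{Y})$, which has definable Skolem functions (via the well-ordering induced by $\pi$). For $a\subseteq H(\omega_2)$, $Sk(a)$ is the closure of $a$ under a fixed set of definable Skolem functions for $\mathcal{A}$. Let $C$ be the (club) set of $\beta<\omega_2$ with $Sk(\beta)\cap\omega_2=\beta$, and let $\Lambda$ be the set of $\beta<\omega_2$ of cofinality $\omega_1$ which are limit points of $C$. Let $\mathcal{X}$ be the set of $M\in\mathcal{Y}$ such that $Sk(M)\cap\omega_2=M$ and for all $\gamma\in M$, $\sup(C\cap\gamma)\in M$. Comparison points and adequacy. Fix a set $\Gamma\subseteq\Lambda$ which is stationary in $\omega_2$. For $M\in\mathcal{X}$, $\Gamma_M$ is the set of $\beta\in\Gamma$ such that $\beta=\min(\Gamma\setminus\sup(M\cap\beta))$, i.e.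 $\Gamma\cap[\sup(M\cap\beta),\beta)=\emptyset$. For $M,N\in\mathcal{X}$, $\Gamma_M\cap\Gamma_N$ has a largest element, denoted $\beta_{M,N}$. A set $A\subseteq\mathcal{X}$ is adequate if for all $M,N\in A$, either $M\cap\beta_{M,N}=N\cap\beta_{M,N}$, or $M\cap\beta_{M,N}\in Sk(N)$, or $N\cap\beta_{M,N}\in Sk(M)$. Remainders. For $\{M,N\}$ adequate, $R_M(N)$ is the set of $\beta$ satisfying either: (1) there is $\gamma\ge\beta_{M,N}$ in $M$ such that $\beta=\min(N\setminus\gamma)$; or (2) $N\cap\beta_{M,N}$ is either equal to $M\cap\beta_{M,N}$ or is in $Sk(M)$, and $\beta=\min(N\setminus\beta_{M,N})$. (Minima are considered only when the set in question is nonempty.) *)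

(* Defs.v *)
From HB Require Import structures.
From mathcomp Require Import all_boot all_classical.

Set Implicit Arguments.
Unset Strict Implicit.
Unset Printing Implicit Defensive.

Local Open Scope classical_set_scope.
Local Open Scope card_scope.
Local Open Scope quotient_scope.

(** The cumulative hierarchy over Rocq's types: well-founded trees (Aczel's
    sets) modulo extensional equality.  It satisfies the axioms of ZFC, so that
    ordinals, cardinals and H(omega_2) below are the genuine set-theoretic
    notions. Subclasses of the universe have type [set zset]; because of
    replacement, cardinalities may be compared by arbitrary functions, as
    [#<=] does. *)

Inductive tree : Type := Node (I : Type) (f : I -> tree).

Fixpoint teq (s t : tree) {struct s} : Prop :=
  match s, t with
  | Node A f, Node B g => (forall i, exists j, teq (f i) (g j)) /\
                          (forall j, exists i, teq (f i) (g j))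
  end.

Lemma teq_refl s : teq s s.
Proof. by elim: s => I f IH /=; split=> i; exists i. Qed.

Lemma teq_sym s t : teq s t -> teq t s.
Proof.
elim: s t => I f IH [J g] /= [fg gf]; split.
- by move=> j; have [i /IH] := gf j; exists i.
- by move=> i; have [j /IH] := fg i; exists j.
Qed.

Lemma teq_trans s t u : teq s t -> teq t u -> teq s u.
Proof.
elim: s t u => I f IH [J g] [K h] /= [fg gf] [gh hg]; split.
- by move=> i; have [j ij] := fg i; have [k jk] := gh j; exists k; apply: IH jk.
- by move=> k; have [j jk] := hg k; have [i ij] := gf j; exists i; apply: IH jk.
Qed.

HB.instance Definition _ := gen_eqMixin tree.
HB.instance Definition _ := gen_choiceMixin tree.

Definition teqb (s t : tree) : bool := `[< teq s t >].

Lemma teqb_equiv : equiv_class_of teqb.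
Proof.
split.
- by move=> s; apply/asboolP/teq_refl.
- by move=> s t; apply/asboolP/asboolP; apply: teq_sym.
- by move=> t s u /asboolP st /asboolP tu; apply/asboolP/(teq_trans st tu).
Qed.

Canonical teqb_equiv_rel := EquivRelPack teqb_equiv.

Definition zset := {eq_quot teqb}.
HB.instance Definition _ := Choice.on zset.
Definition zempty : zset := \pi_zset (Node (of_void tree)).
HB.instance Definition _ := isPointed.Build zset zempty.

Definition elts (x : zset) : set zset :=
  let: Node A f := repr x in range (fun i => \pi_zset (f i)).

Lemma pi_eq (s t : tree) : (\pi_zset s = \pi_zset t) <-> teq s t.
Proof.
split=> [/eqP|st]; first by rewrite eqmodE => /asboolP.
by apply/eqP; rewrite eqmodE; apply/asboolP.
Qed.

Lemma elts_Node (I : Type) (f : I -> tree) :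
  elts (\pi_zset (Node f)) = range (fun i => \pi_zset (f i)).
Proof.
have : teq (repr (\pi_zset (Node f))) (Node f) by apply/pi_eq; rewrite reprK.
rewrite /elts; case: (repr _) => J g /= [gf fg].
apply/seteqP; split=> x /= [i _ <-].
- by have [j ij] := gf i; exists j => //; apply/pi_eq/teq_sym.
- by have [j ij] := fg i; exists j => //; apply/pi_eq.
Qed.

Lemma zset_ext (x y : zset) : elts x = elts y -> x = y.
Proof.
rewrite -[x]reprK -[y]reprK; case: (repr x) (repr y) => I f [J g].
rewrite !elts_Node => /seteqP[fg gf]; apply/pi_eq; split=> i.
- by have [j _ /pi_eq/teq_sym] := fg _ (imageT (fun i => \pi_zset (f i)) i); exists j.
- by have [j _ /pi_eq] := gf _ (imageT (fun i => \pi_zset (g i)) i); exists j.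
Qed.

Lemma elts_wf : well_founded (fun x y => elts y x).
Proof.
move=> x; rewrite -[x]reprK; elim: (repr x) => I f IH.
by constructor=> y; rewrite elts_Node => -[i _ <-].
Qed.

(* The set whose elements are the members of A; junk if A is a proper class. *)
Definition setof (A : set zset) : zset := get [set z | elts z = A].

Lemma eltsK (z : zset) : setof (elts z) = z.
Proof. by apply: zset_ext; apply: (@getPex _ [set u | elts u = elts z]); exists z. Qed.

Lemma elts_setof_sub (A : set zset) (z : zset) :
  A `<=` elts z -> elts (setof A) = A.
Proof.
rewrite -[z]reprK; case: (repr z) => I f; rewrite elts_Node => Asub.
suff [u uA] : exists u, elts u = A by rewrite -uA eltsK.
exists (\pi_zset (Node (fun i : {i : I | A (\pi_zset (f i))} => f (sval i)))).
rewrite elts_Node; apply/seteqP; split=> x /=; first by move=> [[i Ai] _ <-].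
by move=> Ax; have [i _ ix] := Asub _ Ax; rewrite -ix in Ax *; exists (exist _ i Ax).
Qed.

Lemma elts_setof_bigcup (z : zset) :
  elts (setof (\bigcup_(a in elts z) elts a)) = \bigcup_(a in elts z) elts a.
Proof.
set A := \bigcup_(_ in _) _.
suff [u uA] : exists u, elts u = A by rewrite -uA eltsK.
rewrite /A -[z]reprK; case: (repr z) => I f; rewrite elts_Node.
pose dom (t : tree) := let: Node J _ := t in J.
pose sub (t : tree) : dom t -> tree :=
  match t return dom t -> tree with Node _ g => g end.
have subE t : elts (\pi_zset t) = range (fun j => \pi_zset (sub t j)).
  by case: t => J g; rewrite elts_Node.
exists (\pi_zset (Node (fun p : {i : I & dom (f i)} => sub _ (projT2 p)))).
rewrite elts_Node; apply/seteqP; split=> x /=.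
- move=> [[i j] _ <-]; exists (\pi_zset (f i)); first by exists i.
  by rewrite subE; exists j.
- by move=> [_ [i _ <-]]; rewrite subE => -[j _ <-]; exists (existT _ i j).
Qed.

Definition cap (a b : zset) : zset := setof (elts a `&` elts b).

Lemma elts_cap a b : elts (cap a b) = elts a `&` elts b.
Proof. by apply: (@elts_setof_sub _ a) => x []. Qed.

Definition transitive_class (A : set zset) : Prop :=
  forall y, A y -> elts y `<=` A.

Definition trcl (x : zset) : set zset := smallest transitive_class (elts x).

(* Membership is well-founded ([elts_wf]), so it well-orders an ordinal as soon
   as it is trichotomous on it. *)
Definition ordinal (a : zset) : Prop :=
  transitive_class (elts a) /\
  (forall x y, elts a x -> elts a y -> elts y x \/ x = y \/ elts x y).

(* On ordinals, a < b is [elts b a]. *)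
Definition ole (a b : zset) : Prop := elts b a \/ a = b.

Definition is_min (A : set zset) (b : zset) : Prop :=
  A b /\ forall c, A c -> ole b c.

Definition is_max (A : set zset) (b : zset) : Prop :=
  A b /\ forall c, A c -> ole c b.

Definition osup (A : set zset) : zset := setof (\bigcup_(a in A) elts a).

Lemma elts_osup (A : set zset) (z : zset) :
  A `<=` elts z -> elts (osup A) = \bigcup_(a in A) elts a.
Proof. by move=> /elts_setof_sub <-; apply: elts_setof_bigcup. Qed.

(* omega_1 and omega_2, each as the set of its elements: the ordinals of
   cardinality at most aleph_0, respectively at most aleph_1. *)
Definition omega1 : set zset := [set a | ordinal a /\ countable (elts a)].
Definition omega2 : set zset := [set a | ordinal a /\ elts a #<= omega1].

Definition cofinal_map (L : set zset) (b : zset) (f : zset -> zset) : Prop :=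
  (forall x, L x -> elts b (f x)) /\
  (forall c, elts b c -> exists x, L x /\ ole c (f x)).

(* L is the set of elements of the least ordinal with a cofinal map into b. *)
Definition has_cofinality (b : zset) (L : set zset) : Prop :=
  (exists f, cofinal_map L b f) /\
  (forall a, L a -> ~ exists f, cofinal_map (elts a) b f).

Definition limit_point (D : set zset) (b : zset) : Prop :=
  elts b !=set0 /\
  forall c, elts b c -> exists d, [/\ D d, elts b d & elts d c].

Definition club_omega2 (D : set zset) : Prop :=
  [/\ D `<=` omega2,
      forall a, omega2 a -> exists d, D d /\ elts d a &
      forall b, omega2 b -> limit_point D b -> D b].

Definition stationary_omega2 (S : set zset) : Prop :=
  S `<=` omega2 /\ forall D, club_omega2 D -> S `&` D !=set0.

Definition Pomega1_omega2 : set zset :=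
  [set a | elts a `<=` omega2 /\ countable (elts a)].

Definition club_P (D : set zset) : Prop :=
  [/\ D `<=` Pomega1_omega2,
      forall a, Pomega1_omega2 a -> exists d, D d /\ elts a `<=` elts d &
      forall (s : nat -> zset) (b : zset),
        (forall n, D (s n)) -> (forall n, elts (s n) `<=` elts (s n.+1)) ->
        elts b = \bigcup_n elts (s n) -> D b].

Definition stationary_P (S : set zset) : Prop :=
  S `<=` Pomega1_omega2 /\ forall D, club_P D -> S `&` D !=set0.

Definition thin (Y : set zset) : Prop :=
  forall b, omega2 b -> [set cap a b | a in Y] #<= omega1.

Definition closed_initial_segments (Y : set zset) : Prop :=
  forall a b, Y a -> omega2 b -> Y (cap a b).

(* |trcl x| < omega_2 *)
Definition Homega2 : set zset := [set x | ~~ (omega2 #<= trcl x)].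

(* [form n]: first-order formulas over (H(omega_2), in, pi, Y), pi being read as
   the relation pi(i) = j, whose free variables are among n variables;
   [FEx] binds variable 0 and shifts the others. *)
Inductive form : nat -> Type :=
| FEq n (i j : 'I_n) : form n
| FMem n (i j : 'I_n) : form n
| FPi n (i j : 'I_n) : form n
| FY n (i : 'I_n) : form n
| FNot n (p : form n) : form n
| FAnd n (p q : form n) : form n
| FEx n (p : form n.+1) : form n.

Definition scons n (x : zset) (e : 'I_n -> zset) : 'I_n.+1 -> zset :=
  fun i => if unlift ord0 i is Some j then e j else x.

Fixpoint sat (pi : zset -> zset) (Y : set zset) n (p : form n) :
    ('I_n -> zset) -> Prop :=
  match p in form m return ('I_m -> zset) -> Prop with
  | FEq _ i j => fun e => e i = e j
  | FMem _ i j => fun e => elts (e j) (e i)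
  | FPi _ i j => fun e => omega2 (e i) /\ pi (e i) = e j
  | FY _ i => fun e => Y (e i)
  | FNot _ p => fun e => ~ sat pi Y p e
  | FAnd _ p q => fun e => sat pi Y p e /\ sat pi Y q e
  | FEx _ p => fun e => exists x, Homega2 x /\ sat pi Y p (scons x e)
  end.

Definition in_dom n (e : 'I_n -> zset) : Prop := forall i, Homega2 (e i).

Definition definable (pi : zset -> zset) (Y : set zset) n
    (f : ('I_n -> zset) -> zset) : Prop :=
  exists p : form n.+1, forall e y, in_dom e -> Homega2 y ->
    sat pi Y p (scons y e) <-> y = f e.

(* A choice of one function for each formula p(x, e), with x the variable 0. *)
Definition skolem_family := forall n, form n.+1 -> ('I_n -> zset) -> zset.

Definition definable_skolem (pi : zset -> zset) (Y : set zset)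
    (sk : skolem_family) : Prop :=
  forall n (p : form n.+1),
    [/\ forall e, in_dom e -> Homega2 (sk n p e),
        forall e, in_dom e -> sat pi Y (FEx p) e ->
          sat pi Y p (scons (sk n p e) e) &
        definable pi Y (sk n p)].

Definition sk_closed (sk : skolem_family) (A : set zset) : Prop :=
  forall n (p : form n.+1) e, (forall i, A (e i)) -> A (sk n p e).

Definition Sk (sk : skolem_family) (a : set zset) : set zset :=
  smallest (sk_closed sk) a.

Definition Cset (sk : skolem_family) : set zset :=
  [set b | omega2 b /\ Sk sk (elts b) `&` omega2 = elts b].

Definition Lambda (sk : skolem_family) : set zset :=
  [set b | [/\ omega2 b, has_cofinality b omega1 & limit_point (Cset sk) b]].

Definition Xset (Y : set zset) (sk : skolem_family) : set zset :=
  [set M | [/\ Y M, Sk sk (elts M) `&` omega2 = elts M &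
               forall c, elts M c -> elts M (osup (Cset sk `&` elts c))]].

(* For ordinals, A \ b is written [A `\` elts b]. *)
Definition GammaM (Gamma : set zset) (M : zset) : set zset :=
  [set b | Gamma b /\
           is_min (Gamma `\` elts (osup (elts M `&` elts b))) b].

(* The largest element of the intersection (which always exists when Gamma is
   stationary, but [get] makes the definition total). *)
Definition cmp_point (Gamma : set zset) (M N : zset) : zset :=
  get (is_max (GammaM Gamma M `&` GammaM Gamma N)).

Definition adequate (Y : set zset) (sk : skolem_family) (Gamma A : set zset) :
    Prop :=
  A `<=` Xset Y sk /\
  forall M N, A M -> A N ->
    let b := cmp_point Gamma M N in
    [\/ cap M b = cap N b, Sk sk (elts N) (cap M b) | Sk sk (elts M) (cap N b)].

Definition remainder (sk : skolem_family) (Gamma : set zset) (M N : zset) :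
    set zset :=
  let b := cmp_point Gamma M N in
  [set x | (exists c, [/\ ole b c, elts M c & is_min (elts N `\` elts c) x]) \/
           ((cap N b = cap M b \/ Sk sk (elts M) (cap N b)) /\
            is_min (elts N `\` elts b) x)].

(* Main.v *)
(** If an ordinal g < omega_2 is a limit of both M and N, then the least point of
    Gamma at or above g is a comparison point of both M and N, so
    g <= beta_{M,N}. If the remainder were infinite, let g be least such that
    infinitely many remainder points lie below g. These points belong to N and
    are at least beta_{M,N}, and between consecutive ones there is a point of M;
    hence g is a common limit of M and N above beta_{M,N}, a contradiction. *)

Require Import Defs.
From mathcomp Require Import all_boot all_classical.
Local Open Scope classical_set_scope.
Local Open Scope card_scope.

Set Implicit Arguments.
Unset Strict Implicit.
Unset Printing Implicit Defensive.

(* [fintype.ordinal] shadows the set-theoretic notion. *)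
Local Notation ordinal := Defs.ordinal.

(** * Ordinals: comparability and least elements *)

Lemma elts_irr (x : zset) : ~ elts x x.
Proof. by elim/(well_founded_induction elts_wf): x => x IH xx; apply: (IH x). Qed.

Lemma elts_asym (x y : zset) : elts y x -> ~ elts x y.
Proof.
elim/(well_founded_induction elts_wf): x y => x IH y xy yx.
exact: (IH y yx x yx xy).
Qed.

Lemma elts_acyclic3 (x y z : zset) : elts y x -> elts z y -> ~ elts x z.
Proof.
elim/(well_founded_induction elts_wf): x y z => x IH y z xy yz zx.
exact: (IH z zx x y zx xy yz).
Qed.

Lemma elts_ordinal (a x : zset) : ordinal a -> elts a x -> ordinal x.
Proof.
move=> [atr atri] ax; split=> [y xy z yz|y z xy xz]; last first.
  by apply: atri; apply: (atr x).
have ay := atr _ ax _ xy; have az := atr _ ay _ yz.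
case: (atri x z ax az) => [zx|[xz|//]].
- by case: (elts_acyclic3 zx yz xy).
- by rewrite -xz in yz; case: (elts_asym yz).
Qed.

(** By induction on both arguments: if no element of either ordinal is at or above the other
    ordinal, the two have the same elements. *)
Lemma ordinal_total (a b : zset) : ordinal a -> ordinal b ->
  elts b a \/ a = b \/ elts a b.
Proof.
elim/(well_founded_induction elts_wf): a b => a IHa.
elim/(well_founded_induction elts_wf) => b IHb oa ob.
have [[y [yb ay]]|ba] := pselect (exists y, elts b y /\ ole a y).
  by left; case: ay => [ya|->//]; apply: ob.1 yb _ ya.
have [[x [xa bx]]|ab] := pselect (exists x, elts a x /\ ole b x).
  by right; right; case: bx => [bx|->//]; apply: oa.1 xa _ bx.
right; left; apply: zset_ext; apply/seteqP; split=> z za.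
- have [//|[zb|bz]] := IHa _ za b (elts_ordinal oa za) ob.
    by case: ab; exists z; split; [|right].
  by case: ab; exists z; split; [|left].
- have [az|[az|//]] := IHb _ za oa (elts_ordinal ob za).
    by case: ba; exists z; split; [|left].
  by case: ba; exists z; split; [|right].
Qed.

Lemma ordinal_ole_or_lt (a b : zset) : ordinal a -> ordinal b ->
  ole a b \/ elts a b.
Proof.
move=> oa ob; have [|[|]] := ordinal_total oa ob; rewrite /ole; tauto.
Qed.

Lemma ole_not_lt (a b : zset) : ole a b -> ~ elts a b.
Proof. by move=> [/elts_asym//|->]; apply: elts_irr. Qed.

Lemma ole_lt_trans (a b c : zset) : ordinal c -> ole a b -> elts c b -> elts c a.
Proof. by move=> oc [ab cb|->//]; apply: oc.1 cb _ ab. Qed.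

Lemma lt_ole_trans (a b c : zset) : ordinal c -> elts b a -> ole b c -> elts c a.
Proof. by move=> oc ab [bc|<-//]; apply: oc.1 bc _ ab. Qed.

(** [A] may be a proper class: well-foundedness of membership ends the descent inside [A] that
    starts at [a]. *)
Lemma ex_min_ordinal (A : set zset) (a : zset) :
  (forall x, A x -> ordinal x) -> A a -> exists m, is_min A m.
Proof.
move=> Ao; elim/(well_founded_induction elts_wf): a => a IH Aa.
have [[y [ya Ay]]|nex] := pselect (exists y, elts a y /\ A y); first exact: IH Ay.
exists a; split=> // c Ac; have [//|ca] := ordinal_ole_or_lt (Ao _ Aa) (Ao _ Ac).
by case: nex; exists c.
Qed.

(** * Successors, and closure of omega_1 and omega_2 under them *)

Lemma ex_range (I : Type) (f : I -> zset) : exists z, elts z = range f.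
Proof.
exists (\pi_zset (Node (fun i => repr (f i))))%qT; rewrite elts_Node.
by apply/seteqP; split=> x [i _ <-]; exists i; rewrite ?reprK.
Qed.

Definition zsucc (a : zset) : zset := setof (elts a `|` [set a]).

Lemma elts_zsucc (a : zset) : elts (zsucc a) = elts a `|` [set a].
Proof.
suff [z za] : exists z, elts z = elts a `|` [set a] by rewrite /zsucc -za eltsK.
have [I [f fa]] : exists (I : Type) (f : I -> zset), elts a = range f.
  by rewrite -[a]reprK; case: (repr a) => I f; rewrite elts_Node; eexists; eexists.
(* The extra index [None] stands for [a] itself. *)
have [z zE] := ex_range (fun o : option I => if o is Some i then f i else a).
exists z; rewrite zE fa; apply/seteqP; split=> x /=.
- by move=> [[i|] _ <-]; [left; exists i | right].
- by move=> [[i _ <-]|->]; [exists (Some i) | exists None].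
Qed.

Lemma zsuccP (a x : zset) : elts (zsucc a) x <-> ole x a.
Proof. by rewrite elts_zsucc. Qed.

Lemma zsucc_inj : injective zsucc.
Proof.
move=> a b ab.
have /zsuccP : elts (zsucc b) a by rewrite -ab; apply/zsuccP; right.
have /zsuccP : elts (zsucc a) b by rewrite ab; apply/zsuccP; right.
by move=> [/elts_asym ba|->] // [].
Qed.

Lemma ordinal_zsucc (a : zset) : ordinal a -> ordinal (zsucc a).
Proof.
move=> oa; split=> [x /zsuccP xa y xy|x y].
  by apply/zsuccP; left; case: xa => [xa|<-//]; apply: oa.1 xa _ xy.
have o z : ole z a -> ordinal z by move=> [/(elts_ordinal oa)|->].
by move=> /zsuccP/o ox /zsuccP/o oy; have := ordinal_total ox oy; tauto.
Qed.

Lemma omega1_zsucc (a : zset) : omega1 a -> omega1 (zsucc a).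
Proof.
move=> [oa ca]; split; first exact: ordinal_zsucc.
rewrite elts_zsucc -bigcup2E; apply: bigcup_countable => // -[|[|n]] _ //=.
Qed.

Lemma omega1_zempty : omega1 zempty.
Proof.
have e0 : elts zempty = set0.
  by rewrite /zempty elts_Node; apply/seteqP; split=> x // [[]].
by split; [split=> x; rewrite e0 | rewrite e0].
Qed.

Lemma omega2_zsucc (a : zset) : omega2 a -> omega2 (zsucc a).
Proof.
move=> [oa /pcard_leP[f]]; split; first exact: ordinal_zsucc.
rewrite elts_zsucc.
(* The values of [f] are shifted up by one, which frees 0 as the image of the new element [a]. *)
pose g x := if x == a then zempty else zsucc (f x).
have e0 x : ~ elts zempty x by rewrite /zempty elts_Node => -[[]].
have ginj : {in elts a `|` [set a] &, injective g}.
  have s0 x : zempty <> zsucc x by move=> s; apply: (e0 x); rewrite s; apply/zsuccP; right.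
  move=> x y /[!inE] xa ya; rewrite /g.
  case: eqVneq => [->|/eqP xna]; case: eqVneq => [->|/eqP yna] //.
  - by move=> /s0.
  - by move=> /esym/s0.
  - move=> /zsucc_inj; apply: (@inj _ _ _ f); rewrite inE.
      by case: xa.
    by case: ya.
rewrite -(card_le_eql (inj_card_eq ginj)); apply: subset_card_le => _ [x xa <-].
rewrite /g; case: eqVneq => [_|/eqP xna]; first exact: omega1_zempty.
by apply: omega1_zsucc; apply: funS; case: xa.
Qed.

Lemma omega2_elts (a x : zset) : omega2 a -> elts a x -> omega2 x.
Proof.
move=> [oa ca] ax; split; first exact: elts_ordinal ax.
by apply: card_le_trans ca; apply: subset_card_le; apply: oa.1.
Qed.

(** * Countable sets and cofinality omega_1 *)

Lemma ex_infinite_omega1 : exists w, omega1 w /\ infinite_set (elts w).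
Proof.
pose zn n := iter n zsucc zempty.
(* The witness [w] is the ordinal omega, collected from the finite ordinals [zn n]. *)
have [w wE] := ex_range zn.
have znP m x : elts (zn m) x -> exists2 k, k < m & x = zn k.
  elim: m x => [x|m IH x /zsuccP[/IH[k km ->]|->]].
  - by rewrite /= /zempty elts_Node => -[[]].
  - by exists k => //; apply: ltnW.
  - by exists m.
have ltzn m k : k < m -> elts (zn m) (zn k).
  elim: m => // m IH; rewrite ltnS leq_eqVlt => /orP[/eqP->|/IH km]; apply/zsuccP.
    by right.
  by left.
exists w; split; first split; first split.
- move=> x; rewrite wE => -[m _ <-] y /znP[k _ ->]; by exists k.
- move=> x y; rewrite wE => -[m _ <-] [k _ <-].
  by case: (ltngtP m k) => [/ltzn|/ltzn|->]; tauto.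
- by rewrite wE; apply: card_le_trans (card_image_le _ _) _.
- have zn_inj : {in [set: nat] &, injective zn}.
    by move=> m k _ _ zmk; case: (ltngtP m k) => // /ltzn; rewrite zmk => /elts_irr.
  by rewrite wE; apply/infiniteP; rewrite (card_le_eqr (inj_card_eq zn_inj)).
Qed.

(** An infinite element of omega_1 maps onto the nonempty countable set [T], so an ordinal below
    omega_1 already has a cofinal map into [b]. *)
Lemma countable_cofinal_not_omega1 (T : set zset) (b : zset) :
  T !=set0 -> countable T -> T `<=` elts b ->
  (forall c, elts b c -> exists2 t, T t & ole c t) -> ~ has_cofinality b omega1.
Proof.
move=> T0 Tc Tb Tcof [_ nocof]; have [w [w1 winf]] := ex_infinite_omega1.
apply: (nocof w w1).
have : T #<= elts w by apply: card_le_trans Tc _; apply/infiniteP.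
move=> /pfcard_geP[TE|[f]]; first by case: T0 => x; rewrite TE.
exists f; split=> [x wx|c /Tcof[t Tt ct]]; first by apply: Tb; apply: funS.
by have [x wx xt] := (@surj _ _ _ _ f) _ Tt; exists x; rewrite xt.
Qed.

Lemma club_above (a : zset) : omega2 a ->
  club_omega2 [set d | omega2 d /\ elts d a].
Proof.
move=> a2; split=> [d []//|b b2|b b2 [[c bc] blim]]; last first.
  have [d [[_ da] bd _]] := blim c bc.
  by split=> //; apply: b2.1.1 bd _ da.
have [ab|ba] := ordinal_ole_or_lt a2.1 b2.1.
- exists (zsucc b); split; last by apply/zsuccP; right.
  by split; [exact: omega2_zsucc | apply/zsuccP].
- exists (zsucc a); split; last by apply/zsuccP; left.
  by split; [exact: omega2_zsucc | apply/zsuccP; right].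
Qed.

(* An unbounded countable [A] would make its limit points together with the
   successors of its elements a club, none of whose points has cofinality
   omega_1. *)
Lemma countable_bounded (G A : set zset) : stationary_omega2 G ->
  (forall b, G b -> has_cofinality b omega1) ->
  A `<=` omega2 -> countable A -> exists2 d, omega2 d & A `<=` elts d.
Proof.
move=> [G2 Gstat] Gcof A2 Ac; apply: contrapT => nbd.
have unb a : omega2 a -> exists2 x, A x & ole a x.
  move=> a2; apply: contrapT => nx; apply: nbd; exists a => // x Ax.
  have [ax|//] := ordinal_ole_or_lt a2.1 (A2 _ Ax).1.
  by case: nx; exists x.
pose D := [set b | omega2 b /\ limit_point A b] `|` (zsucc @` A).
have Dclub : club_omega2 D.
  split=> [b [[]//|[a /A2 a2 <-]]|a a2|b b2 [b0 blim]]; first exact: omega2_zsucc.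
    by have [x Ax ax] := unb a a2; exists (zsucc x); split; [right; exists x|apply/zsuccP].
  left; split=> //; split=> // c bc.
  (* One point of [D] above [c] would not do: it could be the successor of [c], with no element of
     [A] strictly above [c] to offer. Hence two points, [d] below [e]. *)
  have [d [Dd bd dc]] := blim c bc; have [e [De be ed]] := blim d bd.
  case: De => [[e2 [_ elim]]|[a Aa ae]].
    have [a [Aa ea ad]] := elim d ed; exists a; split=> //; first exact: b2.1.1 be _ ea.
    exact: (A2 _ Aa).1.1 ad _ dc.
  rewrite -ae in ed be; exists a; split=> //.
    by apply: b2.1.1 be _ _; apply/zsuccP; right.
  by apply: lt_ole_trans dc _; [exact: (A2 _ Aa).1 | apply/zsuccP].
have [b [Gb]] := Gstat _ Dclub.
have bcof := Gcof _ Gb.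
case=> [[b2 [[c bc] blim]]|[a Aa ab]].
- apply: (@countable_cofinal_not_omega1 (A `&` elts b) b) bcof => //.
  + by have [d [Ad bd _]] := blim c bc; exists d.
  + by apply: card_le_trans Ac; apply: subset_card_le.
  + by move=> x bx; have [d [Ad bd dx]] := blim x bx; exists d; [|left].
- rewrite -ab in bcof.
  apply: (@countable_cofinal_not_omega1 [set a] (zsucc a)) bcof.
  + by exists a.
  + exact: countable1.
  + by move=> _ ->; apply/zsuccP; right.
  + by move=> x /zsuccP xa; exists a.
Qed.

(** * Comparison points and common limits *)

Lemma elts_sup_initial (M b x : zset) :
  elts (osup (elts M `&` elts b)) x <->
  exists m, [/\ elts M m, elts b m & elts m x].
Proof.
rewrite (@elts_osup _ M); last by move=> y [].
by split=> [[m [Mm bm] mx]|[m [Mm bm mx]]]; exists m.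
Qed.

(** As [t] is the least point of [Gamma] not below the supremum of [M] under [t], the smaller point
    [s] must lie below that supremum. *)
Lemma GammaM_lt (Gamma : set zset) (M s t : zset) :
  GammaM Gamma M t -> Gamma s -> elts t s ->
  exists m, [/\ elts M m, elts t m & elts m s].
Proof.
move=> [_ [_ tmin]] Gs ts; apply/elts_sup_initial; apply: contrapT => ns.
exact: (ole_not_lt (tmin s (conj Gs ns))).
Qed.

(** Since [M] is cofinal in [g] and [g] is at most [b], the supremum of [M] under [b] is at least
    [g]; minimality from [g] on thus gives minimality from that supremum on. *)
Lemma GammaM_of_cofinal (Gamma : set zset) (M g b : zset) :
  ordinal b -> is_min (Gamma `\` elts g) b ->
  (forall c, elts g c -> exists m, [/\ elts M m, elts g m & elts m c]) ->
  ole g b -> GammaM Gamma M b.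
Proof.
move=> ob [[Gb gb] bmin] Mg gleb; split=> //; split=> [|c [Gc nc]].
  split=> // /elts_sup_initial[m [_ bm mb]]; exact: elts_asym bm mb.
apply: bmin; split=> // gc; apply: nc; apply/elts_sup_initial.
have [m [Mm gm mc]] := Mg c gc; exists m; split=> //.
by case: gleb => [bg|<-//]; apply: ob.1 bg _ gm.
Qed.

Section ComparisonPoint.

Variables (Gamma : set zset) (M N : zset).
Hypotheses (Gamma_stat : stationary_omega2 Gamma)
  (Gamma_cof : forall b, Gamma b -> has_cofinality b omega1)
  (M2 : elts M `<=` omega2) (Mc : countable (elts M)).

Let S := GammaM Gamma M `&` GammaM Gamma N.

Let S_Gamma b : S b -> Gamma b. Proof. by case=> -[]. Qed.

(** Serves both to show that the largest common point exists and to bound common limits by it. The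
    choice of [b] depends on [Gamma] and [g] only, hence suits [M] and [N] at once. *)
Lemma ex_common_min_above (g : zset) : omega2 g ->
  (forall c, elts g c -> exists m, [/\ elts M m, elts g m & elts m c]) ->
  (forall c, elts g c -> exists m, [/\ elts N m, elts g m & elts m c]) ->
  exists2 b, S b & ole g b.
Proof.
move=> g2 Mg Ng; have [d [Gd [_ dg]]] := Gamma_stat.2 _ (club_above g2).
have Gord b : Gamma b -> ordinal b by move/Gamma_stat.1 => -[].
have [b bmin] : exists b, is_min (Gamma `\` elts g) b.
  apply: (@ex_min_ordinal _ d) => [x [/Gord]//|]; split=> //; exact: elts_asym.
have ob := Gord _ bmin.1.1.
have gb : ole g b by have [//|/bmin.1.2] := ordinal_ole_or_lt g2.1 ob.
by exists b => //; split; apply: GammaM_of_cofinal bmin _ gb.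
Qed.

(** Without a maximum, the supremum [g] of [S] would be a limit of both [M] and [N], and so some
    point of [S] would lie at or above [g]. An empty [S] is covered too, with [g] equal to 0. *)
Lemma cmp_point_max : is_max S (cmp_point Gamma M N).
Proof.
suff [b bmax] : exists b, is_max S b by apply: (@getPex _ (is_max S)); exists b.
apply: contrapT => nomax.
have So b : S b -> ordinal b by move/S_Gamma/Gamma_stat.1 => -[].
have up s : S s -> exists2 t, S t & elts t s.
  move=> Ss; apply: contrapT => nt; apply: nomax; exists s; split=> // c Sc.
  have [//|cs] := ordinal_ole_or_lt (So _ Sc) (So _ Ss).
  by case: nt; exists c.
have [d d2 Md] := countable_bounded Gamma_stat Gamma_cof M2 Mc.
(* Between a point of [S] and a larger one there is an element of [M], so a bound for [M] bounds
   [S]. *)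
have Sd : S `<=` elts d.
  move=> s Ss; have [t St ts] := up s Ss.
  have [m [Mm _ ms]] := GammaM_lt St.1 (S_Gamma Ss) ts.
  exact: d2.1.1 (Md _ Mm) _ ms.
have [g [[g2 Sg] gmin]] : exists g, is_min [set g | omega2 g /\ S `<=` elts g] g.
  by apply: (@ex_min_ordinal _ d) => // x [[]].
(* Some [s] is at or above [c] because [c] is too small to bound [S]; [t] exists because [s] is not
   the maximum. *)
have above c : elts g c -> exists s t, [/\ S s, S t, ole c s & elts t s].
  move=> gc; have c2 := omega2_elts g2 gc.
  have [s Ss cs] : exists2 s, S s & ole c s.
    apply: contrapT => ns; apply: (ole_not_lt (gmin c _) gc); split=> // s Ss.
    have [cs|//] := ordinal_ole_or_lt c2.1 (So _ Ss).
    by case: ns; exists s.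
  by have [t St ts] := up s Ss; exists s, t.
have cofinal K : (forall t, S t -> GammaM Gamma K t) ->
    forall c, elts g c -> exists m, [/\ elts K m, elts g m & elts m c].
  move=> SK c gc; have [s [t [Ss St cs ts]]] := above c gc.
  have [m [Km tm ms]] := GammaM_lt (SK _ St) (S_Gamma Ss) ts; exists m; split=> //.
    exact: g2.1.1 (Sg _ St) _ tm.
  exact: ole_lt_trans (elts_ordinal (So _ St) tm) cs ms.
have [b Sb gb] := ex_common_min_above g2 (cofinal M (fun t => @proj1 _ _))
  (cofinal N (fun t => @proj2 _ _)).
exact: ole_not_lt gb (Sg _ Sb).
Qed.

Lemma common_limit_ole_cmp_point (g : zset) : omega2 g ->
  (forall c, elts g c -> exists m, [/\ elts M m, elts g m & elts m c]) ->
  (forall c, elts g c -> exists m, [/\ elts N m, elts g m & elts m c]) ->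
  ole g (cmp_point Gamma M N).
Proof.
move=> g2 Mg Ng; have [b Sb gb] := ex_common_min_above g2 Mg Ng.
have [Sp pmax] := cmp_point_max.
have op : ordinal (cmp_point Gamma M N) by have [] := Gamma_stat.1 _ (S_Gamma Sp).
case: gb => [bg|->]; last exact: pmax.
by left; apply: lt_ole_trans op bg (pmax _ Sb).
Qed.

End ComparisonPoint.

(** * Limits of infinite sets of ordinals, and finiteness of the remainder *)

Lemma infinite_limit (R : set zset) (d : zset) :
  ordinal d -> R `<=` elts d -> infinite_set R ->
  exists g, [/\ ole g d, R `&` elts g !=set0 &
    forall c, elts g c -> exists r s,
      [/\ R r /\ R s, elts g r, elts g s, elts r c & elts s r]].
Proof.
move=> od Rd Rinf.
have [g [[og gd Rg] gmin]] : exists g, is_min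
    [set g | [/\ ordinal g, ole g d & infinite_set (R `&` elts g)]] g.
  apply: (@ex_min_ordinal _ d) => [x []//|]; split=> //; first by right.
  by rewrite (setIidl Rd).
(* Only finitely many points of [R] lie below [c], and [c] itself adds at most one, so some point of
   [R] lies strictly between [c] and [g]. *)
have pick c : elts g c -> exists r, [/\ R r, elts g r & elts r c].
  move=> gc; apply: contrapT => nr.
  have oc := elts_ordinal og gc.
  have fin : finite_set (R `&` elts c).
    apply: contrapT => inf; apply: (ole_not_lt (gmin c _) gc); split=> //.
    by left; apply: lt_ole_trans gc gd.
  apply: Rg; apply: (@sub_finite_set _ _ ((R `&` elts c) `|` [set c])).
    move=> r [Rr gr].
    have [[cr|->]|rc] := ordinal_ole_or_lt (elts_ordinal og gr) oc.
    - by left.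
    - by right.
    - by case: nr; exists r.
  by rewrite finite_setU; split=> //; apply: finite_set1.
exists g; split=> // [|c gc]; first exact: infinite_setN0.
(* Two points are taken so that an element of [M] can later be placed between them. *)
have [r [Rr gr rc]] := pick c gc; have [s [Rs gs sr]] := pick r gr.
by exists r, s.
Qed.

Theorem proposition2p9
  (pow_omega1 : [set X : set zset | X `<=` omega1] #= omega2)
  (pi : zset -> zset) (pi_bij : set_bij omega2 Homega2 pi)
  (Y : set zset) (Y_stat : stationary_P Y) (Y_thin : thin Y)
  (Y_init : closed_initial_segments Y)
  (sk : skolem_family) (sk_def : definable_skolem pi Y sk)
  (Gamma : set zset) (Gamma_sub : Gamma `<=` Lambda sk)
  (Gamma_stat : stationary_omega2 Gamma)
  (M N : zset) (XM : Xset Y sk M) (XN : Xset Y sk N)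
  (MN_adequate : adequate Y sk Gamma [set M; N]) :
  finite_set (remainder sk Gamma M N).
Proof.
have Gcof b : Gamma b -> has_cofinality b omega1 by case/Gamma_sub.
have [M2 Mc] : Pomega1_omega2 M by apply: Y_stat.1; case: XM.
have [N2 Nc] : Pomega1_omega2 N by apply: Y_stat.1; case: XN.
have [d d2 Nd] := countable_bounded Gamma_stat Gcof N2 Nc.
have limit_le := common_limit_ole_cmp_point Gamma_stat Gcof M2 Mc (N := N).
(* The maximum exists, so [get] does not fall back on its default value and the comparison point
   belongs to [Gamma]. *)
have [[[Gb _] _] _] := cmp_point_max N Gamma_stat Gcof M2 Mc.
rewrite /remainder; set b := cmp_point Gamma M N in limit_le Gb *.
set R := [set x | _].
have ob : ordinal b by have [] := Gamma_stat.1 _ Gb.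
have RN x : R x -> elts N x by move=> [[c [_ _ [[]]]]|[_ [[]]]].
have oN x : elts N x -> ordinal x by move/N2 => [].
have Rb x : R x -> ole b x.
  move=> Rx; have ox := oN x (RN x Rx).
  have [//|bx] := ordinal_ole_or_lt ob ox.
  case: Rx => [[c [bc Mc' [[_ nc] _]]]|[_ [[_ /(_ bx)]]]] //.
  by case: nc; apply: lt_ole_trans bx bc; case: (M2 _ Mc').
(* A remainder point of clause (2) is the least one, so every other point comes
   from clause (1). *)
have between r s : R r -> R s -> elts s r ->
    exists c, [/\ elts M c, elts c r & ole c s].
  move=> Rr Rs sr; have Nr := RN r Rr.
  case: Rs => [[c [bc Mc' [[Ns nc] smin]]]|[_ [_ smin]]].
    exists c; split=> //.
      by apply: contrapT => ncr; apply: ole_not_lt (smin r _) sr.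
    by have [//|] := ordinal_ole_or_lt (M2 _ Mc').1 (oN s Ns).
  by case: (ole_not_lt (smin r _) sr); split=> //; apply: ole_not_lt (Rb r Rr).
apply: contrapT => Rinf.
have [g [gd [x [Rx gx]] glim]] := infinite_limit d2.1 (fun x Rx => Nd x (RN x Rx)) Rinf.
have g2 : omega2 g by case: gd => [/(omega2_elts d2)|->].
apply: (ole_not_lt (limit_le g g2 _ _)).
(* [M] is cofinal in [g]: its element [m] satisfies c < r < m <= s < g. *)
- move=> c gc; have [r [s [[Rr Rs] _ gs rc sr]]] := glim c gc.
  have [m [Mm mr ms]] := between r s Rr Rs sr.
  exists m; split=> //; first exact: ole_lt_trans g2.1 ms gs.
  exact: (M2 _ Mm).1.1 mr _ rc.
- move=> c gc; have [r [_ [[Rr _] gr _ rc _]]] := glim c gc.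
  by exists r; split=> //; apply: RN.
(* A single remainder point [x] below [g] puts the comparison point strictly below [g]. *)
- exact: ole_lt_trans g2.1 (Rb x Rx) gx.
Qed.
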